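(* There exists a family of $n$-bit communication problems $F_n:\{0,1\}^n\times\{0,1\}^n\to\{0,1\}$ with $\mathsf{PP}(F_n)=O(\log n)$ and $\mathrm{rect}(F_n)^{-1}=2^{\Omega(n)}$. In particular, $\mathsf{D}^{\mathsf{NP}}(F_n)=\Omega(n)$, and the communication class $\mathsf{PP}$ is not contained in the communication class $\mathsf{P}^{\mathsf{NP}}$.
   Context: For a Boolean matrix $F\in\{0,1\}^{\mathcal X\times\mathcal Y}$: a monochromatic rectangle is a set $S\times T$ ($S\subseteq\mathcal X,T\subseteq\mathcal Y$) on which $F$ is constant, and $\mathrm{rect}(F)=\max_R |R|/|\mathcal X\times\mathcal Y|$ over monochromatic rectangles $R$. A deterministic protocol is a binary tree whose internal nodes are owned by Alice (labelled by a function of $x$ into $\{0,1\}$) or Bob (a function of $y$); the leaf reached on $(x,y)$ gives the output; cost is the height. A nondeterministic protocol is a family of deterministic protocols $\pi_a$ indexed by advice strings $a\in\{0,1\}^k$, computing $F$ if $F(x,y)=1\iff\exists a:\pi_a(x,y)=1$, with cost $k$ plus the maximum cost of the $\pi_a$; $\mathsf{N}(F)$ is the minimum such cost. An oracle protocol is a deterministic protocol tree in which some internal nodes $v$ are instead labelled by a triple $(P_v,a_v,b_v)$, where $P_v$ is a Boolean matrix on some $\mathcal X'\times\mathcal Y'$, $a_v:\mathcal X\to\mathcal X'$, $b_v:\mathcal Y\to\mathcal Y'$, and the branch taken at $v$ is $P_v(a_v(x),b_v(y))$. The $\mathsf{D}^{\mathsf{NP}}$ cost of a root-to-leaf path is the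 number of communicated bits on it plus $\sum_v \mathsf{N}(P_v)$ over oracle nodes $v$ on it; the cost of the protocol is the maximum over paths, and $\mathsf{D}^{\mathsf{NP}}(F)$ is the minimum cost of an oracle protocol computing $F$. A public-coin randomized protocol is a probability distribution over deterministic protocols (chosen using shared randomness), with cost the maximum cost of the protocols in the support; $\mathsf{R}_\epsilon(F)$ is the minimum cost of such a protocol whose output differs from $F(x,y)$ with probability at most $\epsilon$ for every input $(x,y)$. Define $\mathsf{PP}(F)=\min_{\epsilon<1/2}\big(\mathsf{R}_\epsilon(F)+\log_2\frac{1}{1/2-\epsilon}\big)$. The class $\mathsf{PP}$ (resp. $\mathsf{P}^{\mathsf{NP}}$) consists of families of $n$-bit problems $F_n$ (matrices with $\lceil\log_2\max(|\mathcal X|,|\mathcal Y|)\rceil=n$) with $\mathsf{PP}(F_n)$ (resp. $\mathsf{D}^{\mathsf{NP}}(F_n)$) bounded by a polylogarithmic function of $n$. *)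

(* Defs.v *)
From HB Require Import structures.
From mathcomp Require Import all_boot all_order all_algebra.
From mathcomp Require Import boolp classical_sets reals exp.
Set Implicit Arguments. Unset Strict Implicit. Unset Printing Implicit Defensive.
Import Order.TTheory GRing.Theory Num.Theory.
Local Open Scope ring_scope.

Lemma natmin_ex (P : nat -> Prop) : (exists n, P n) -> exists n, `[< P n >].
Proof. by case=> n Pn; exists n; apply: asboolT. Qed.

(* natmin P = least n with P n, if some n satisfies P; 0 otherwise
   (the default is never used in the statement: all minima below exist). *)
Definition natmin (P : nat -> Prop) : nat :=
  match pselect (exists n, P n) with
  | left h => ex_minn (natmin_ex h)
  | right _ => 0%N
  end.

Definition bits (n : nat) := n.-tuple bool.

Inductive proto (X Y : Type) : Type :=
| Leaf of bool
| ANode of (X -> bool) & proto X Y & proto X Y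
| BNode of (Y -> bool) & proto X Y & proto X Y.

Fixpoint peval X Y (p : proto X Y) (x : X) (y : Y) : bool :=
  match p with
  | Leaf b => b
  | ANode f p0 p1 => if f x then peval p1 x y else peval p0 x y
  | BNode g p0 p1 => if g y then peval p1 x y else peval p0 x y
  end.

Fixpoint pheight X Y (p : proto X Y) : nat :=
  match p with
  | Leaf _ => 0
  | ANode _ p0 p1 => (maxn (pheight p0) (pheight p1)).+1
  | BNode _ p0 p1 => (maxn (pheight p0) (pheight p1)).+1
  end.

Definition nd_computes X Y (F : X -> Y -> bool) k (pi : k.-tuple bool -> proto X Y) :=
  forall x y, F x y = [exists a : k.-tuple bool, peval (pi a) x y].

Definition nd_cost X Y k (pi : k.-tuple bool -> proto X Y) : nat :=
  (k + \max_(a : k.-tuple bool) pheight (pi a))%N.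

Definition Ncc X Y (F : X -> Y -> bool) : nat :=
  natmin (fun c => exists k (pi : k.-tuple bool -> proto X Y),
                     nd_computes F pi /\ nd_cost pi = c).

Inductive oproto (X Y : Type) : Type :=
| OLeaf of bool
| OANode of (X -> bool) & oproto X Y & oproto X Y
| OBNode of (Y -> bool) & oproto X Y & oproto X Y
| OOracle (X' Y' : finType) (P : X' -> Y' -> bool) (a : X -> X') (b : Y -> Y')
          of oproto X Y & oproto X Y.

Fixpoint oeval X Y (p : oproto X Y) (x : X) (y : Y) : bool :=
  match p with
  | OLeaf b => b
  | OANode f p0 p1 => if f x then oeval p1 x y else oeval p0 x y
  | OBNode g p0 p1 => if g y then oeval p1 x y else oeval p0 x y
  | OOracle _ _ P a b p0 p1 => if P (a x) (b y) then oeval p1 x y else oeval p0 x y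
  end.

Fixpoint ocost X Y (p : oproto X Y) : nat :=
  match p with
  | OLeaf _ => 0
  | OANode _ p0 p1 => (maxn (ocost p0) (ocost p1)).+1
  | OBNode _ p0 p1 => (maxn (ocost p0) (ocost p1)).+1
  | OOracle _ _ P _ _ p0 p1 => (Ncc P + maxn (ocost p0) (ocost p1))%N
  end.

Definition DNP X Y (F : X -> Y -> bool) : nat :=
  natmin (fun c => exists p : oproto X Y,
                     (forall x y, oeval p x y = F x y) /\ ocost p = c).

Section Real.
Variable R : realType.

(* a finitely supported probability distribution over deterministic protocols *)
Definition rproto (X Y : Type) := seq (R * proto X Y).

Definition rvalid X Y (s : rproto X Y) :=
  all (fun q => 0 <= q.1) s /\ \sum_(q <- s) q.1 = 1.

Definition rcost X Y (s : rproto X Y) : nat :=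
  \max_(q <- s | 0 < q.1) pheight q.2.

Definition rerr X Y (F : X -> Y -> bool) (s : rproto X Y) (x : X) (y : Y) : R :=
  \sum_(q <- s | peval q.2 x y != F x y) q.1.

Definition Rcc X Y (eps : R) (F : X -> Y -> bool) : nat :=
  natmin (fun c => exists s : rproto X Y,
     rvalid s /\ (forall x y, rerr F s x y <= eps) /\ rcost s = c).

Definition log2 (x : R) : R := ln x / ln 2.

Definition PPcc X Y (F : X -> Y -> bool) : R :=
  inf [set ((Rcc eps F)%:R + log2 (1 / (2^-1 - eps))) | eps in
         [set e : R | 0 <= e /\ e < 2^-1]]%classic.

Definition monorect (X Y : finType) (F : X -> Y -> bool) (S : {set X}) (T : {set Y}) :=
  [exists b : bool, [forall x in S, forall y in T, F x y == b]].

Definition rect (X Y : finType) (F : X -> Y -> bool) : R :=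
  \big[Num.max/0]_(S : {set X})
    \big[Num.max/0]_(T : {set Y} | monorect F S T)
      ((#|S| * #|T|)%:R / (#|X| * #|Y|)%:R).

Definition bfamily := forall n : nat, bits n -> bits n -> bool.

Definition in_PP (F : bfamily) : Prop :=
  exists (C : R) (k N0 : nat), forall n, (N0 <= n)%N ->
    PPcc (F n) <= C * (log2 n%:R) ^+ k.

Definition in_PNP (F : bfamily) : Prop :=
  exists (C : R) (k N0 : nat), forall n, (N0 <= n)%N ->
    (DNP (F n))%:R <= C * (log2 n%:R) ^+ k.

End Real.

(* Main.v *)
(* [F_n x y = 1] iff the Hamming distance of [x] and [y] exceeds [n / 2].
   Comparing a random coordinate guesses [F_n] with advantage [1 / O(n)], so
   [PP (F_n) = O(log n)].  A monochromatic rectangle [S * T] has all distances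
   at least [n / 2] (after complementing [T] if [F_n = 0] on it), and two-set
   isoperimetry, by induction on [n], then makes it exponentially small.
   Finally a P^NP protocol of cost [c] has a monochromatic rectangle of density
   [2 ^ (- 4 c)]: an oracle query [P] is a union of [2 ^ N(P)] rectangles, and
   either one of them is large, which fixes the answer to 1, or deleting a
   short side of each leaves a large rectangle on which the answer is 0. *)
Require Import Defs.
From HB Require Import structures.
From mathcomp Require Import all_boot all_order all_algebra.
From mathcomp Require Import boolp classical_sets reals exp.
From mathcomp Require Import zify ring lra.
Set Implicit Arguments. Unset Strict Implicit. Unset Printing Implicit Defensive.
Import Order.TTheory GRing.Theory Num.Theory.

(** * Hamming distance and the threshold problem *)

Definition hamming n (x y : bits n) : nat := \sum_(i < n) (tnth x i != tnth y i).

Definition far : bfamily := fun n x y => n < 2 * hamming x y.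

Lemma hamming_cons n a b (x y : bits n) :
  hamming (cons_tuple a x) (cons_tuple b y) = (a != b) + hamming x y.
Proof.
rewrite /hamming big_ord_recl !tnth0; congr addn.
by apply: eq_bigr => i _; rewrite !tnthS.
Qed.

(** * Isoperimetry in the cube and monochromatic rectangles of [far] *)

Definition section n (S : {set bits n.+1}) b : {set bits n} :=
  [set x | cons_tuple b x \in S].

Lemma card_section n (S : {set bits n.+1}) :
  #|S| = #|section S false| + #|section S true|.
Proof.
have sectionE b : #|section S b| = #|[set x in S | thead x == b]|.
  rewrite -(card_imset _ (f := cons_tuple b)); last first.
    by move=> x y /(congr1 val) [] /val_inj.
  apply: eq_card => x; case/tupleP: x => c t; rewrite !inE theadE.
  apply/imsetP/andP => [[y yS /(congr1 val) [-> /val_inj ->]]|[tS /eqP <-]].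
    by rewrite inE in yS.
  by exists t; rewrite ?inE.
rewrite !sectionE addnC -(cardsID [set x | thead x] S); congr addn; apply: eq_card => x;
  by rewrite !inE ?eqb_id ?eqbF_neg // andbC.
Qed.

(* [p + q] is largest at the end point [p = 4 m], [q = m / 4] of the
   hyperbola [p q = m ^ 2]. *)
Lemma hyperbola_sum_le m p q :
  p <= 4 * m -> q <= 4 * m -> p * q <= m * m -> 4 * (p + q) <= 17 * m.
Proof.
move=> p4 q4 pq; case: (leqP p m) => pm; first case: (leqP q m) => qm; nia.
Qed.

(* In densities: [mu S * mu T <= (25 / 16) ^ n / 4 ^ d]. *)
Lemma cross_distance_card n d (S T : {set bits n}) :
  (forall x y, x \in S -> y \in T -> d <= hamming x y) ->
  #|S| * #|T| * 4 ^ (n + d) <= 25 ^ n.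
Proof.
elim: n d S T => [|n IH] d S T dST.
  have [->|/set0Pn[x xS]] := eqVneq S finset.set0; first by rewrite cards0.
  have [->|/set0Pn[y yT]] := eqVneq T finset.set0; first by rewrite cards0 muln0.
  have := dST x y xS yT; rewrite /hamming big_ord0 leqn0 => /eqP ->.
  have le1 (U : {set bits 0}) : #|U| <= 1.
    by apply: leq_trans (max_card _) _; rewrite card_tuple expn0.
  by rewrite !muln1 (leq_mul (le1 S) (le1 T)).
have dsec b c x y : x \in section S b -> y \in section T c ->
    d <= (b != c) + hamming x y.
  by rewrite !inE -hamming_cons; apply: dST.
have diag b : #|section S b| * #|section T b| * 4 ^ (n + d) <= 25 ^ n.
  by apply: IH => x y xS yT; have := dsec b b x y xS yT; rewrite eqxx.
(* Unequal first bits account for one unit of distance, so the tails satisfy the hypothesis for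
   [d.-1]; when [d] is 0 the extra factor 4 is mere slack. *)
have offdiag b c : #|section S b| * #|section T c| * 4 ^ (n + d) <= 4 * 25 ^ n.
  have := IH d.-1 (section S b) (section T c).
  have dd : 4 ^ (n + d) <= 4 * 4 ^ (n + d.-1).
    by rewrite -expnS leq_exp2l //; lia.
  move=> H; apply: leq_trans (leq_mul (leqnn _) dd) _.
  rewrite mulnCA leq_mul2l /=; apply: H => x y xS yT.
  by have := dsec b c x y xS yT; case: (b != c) => /=; lia.
have := hyperbola_sum_le (offdiag false true) (offdiag true false).
rewrite !card_section addSn !expnS.
move: (diag false) (diag true).
move: #|section S false| #|section S true| #|section T false| #|section T true|
  (4 ^ _) (25 ^ n) => a0 a1 b0 b1 w m h0 h1 hyp.
have := leq_mul h0 h1 => prod.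
have {hyp} := hyp _.
(* Both pairs of terms multiply the same four slices, so the off-diagonal product is at most [m * m]
   and the hyperbola bound applies. The total is then at most 4 m + 4 m + 17 m = 25 m. *)
rewrite (_ : a0 * b1 * w * (a1 * b0 * w) = a0 * b0 * w * (a1 * b1 * w)); last by ring.
move=> /(_ prod) hyp.
rewrite (_ : (a0 + a1) * (b0 + b1) * (4 * w) =
  4 * (a0 * b0 * w) + 4 * (a1 * b1 * w) + 4 * (a0 * b1 * w + a1 * b0 * w)); last by ring.
lia.
Qed.

Lemma hamming_negb n (x y : bits n) :
  hamming x (map_tuple negb y) + hamming x y = n.
Proof.
rewrite /hamming -big_split /= -[RHS]card_ord -sum1_card; apply: eq_bigr => i _.
by rewrite tnth_map; case: (tnth x i) (tnth y i) => [] [].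
Qed.

Lemma map_tuple_negb_inj n : injective (map_tuple negb : bits n -> bits n).
Proof. by move=> x y /(congr1 val) /= /(inj_map negb_inj) /val_inj. Qed.

(** With [d] equal to [n / 2] rounded up, [4 ^ d] is at least [2 ^ n], so the isoperimetric bound on
    the density becomes (25/16)^n / 2^n = (25/32)^n. *)
Lemma far_monorect_card n (S T : {set bits n}) :
  monorect (@far n) S T -> #|S| * #|T| * 32 ^ n <= 100 ^ n.
Proof.
have [d [d1 d2]] : exists d, n <= 2 * d /\ 2 * d <= n.+1.
  by exists (uphalf n); rewrite uphalfE; lia.
have pow (m : nat) : m * 4 ^ (n + d) <= 25 ^ n -> m * 32 ^ n <= 100 ^ n.
  have -> : 100 = 4 * 25 by []. have -> : 32 = 4 * (4 * 2) by [].
  move=> h; rewrite !expnMn mulnCA leq_mul2l expn_eq0 /=.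
  apply: leq_trans h; rewrite leq_mul2l expnD leq_mul2l expn_eq0 /=.
  by rewrite (_ : 4 ^ d = 2 ^ (2 * d)) ?leq_exp2l ?d1 ?orbT // expnM.
move=> /existsP[[] /'forall_implyP mono].
  apply/pow/cross_distance_card => x y xS yT.
  by have /'forall_implyP/(_ y yT) := mono x xS; rewrite /far; lia.
rewrite -(card_imset (mem T) (@map_tuple_negb_inj n)).
apply/pow/cross_distance_card => x _ xS /imsetP[y yT ->].
have /'forall_implyP/(_ y yT) := mono x xS.
by have := hamming_negb x y; rewrite /far; lia.
Qed.

(** * Minimal costs and rectangle covers *)

Lemma natminP (P : nat -> Prop) : (exists n, P n) -> P (natmin P).
Proof.
by rewrite /natmin => exP; case: pselect => // h; case: ex_minnP => m /asboolP.
Qed.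

Lemma natmin_le (P : nat -> Prop) n : P n -> natmin P <= n.
Proof.
move=> Pn; rewrite /natmin; case: pselect => // h.
by case: ex_minnP => m _; apply; apply/asboolP.
Qed.

(** Alice tests her input against each row in turn, then Bob sends the entry. Only existence
    matters: it keeps [natmin] in [Ncc] away from its default 0. *)
Lemma proto_exists (X Y : finType) (P : X -> Y -> bool) :
  exists q : proto X Y, forall x y, peval q x y = P x y.
Proof.
suff [q qP] : exists q : proto X Y, forall x y, x \in enum X -> peval q x y = P x y.
  by exists q => x y; apply: qP; rewrite mem_enum.
elim: (enum X) => [|x0 s [q qP]]; first by exists (Leaf X Y false).
exists (ANode (pred1 x0) q (BNode (P x0) (Leaf X Y false) (Leaf X Y true))) => x y.
by rewrite inE /=; case: eqP => [-> _|_ /qP //]; case: (P x0 y).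
Qed.

Lemma NccP (X Y : finType) (P : X -> Y -> bool) :
  exists k (pi : k.-tuple bool -> proto X Y),
    nd_computes P pi /\ nd_cost pi = Ncc P.
Proof.
apply: (natminP (P := fun c => exists k (pi : k.-tuple bool -> proto X Y),
  nd_computes P pi /\ nd_cost pi = c)).
have [q qP] := proto_exists P; exists (nd_cost (fun _ : 0.-tuple bool => q)).
exists 0, (fun=> q); split => // x y; apply/idP/existsP => [Pxy|[_]]; last by rewrite qP.
by exists [tuple]; rewrite qP.
Qed.

Definition covers X Y (P : X -> Y -> bool) (L : seq (pred X * pred Y)) :=
  forall x y, P x y = has (fun r => r.1 x && r.2 y) L.

Lemma has_andl T (b : bool) (p : pred T) (L : seq T) :
  has (fun r => b && p r) L = b && has p L.
Proof. by case: b => //; rewrite /= has_pred0. Qed.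

(** The inputs reaching a given leaf form a rectangle; the cover takes one for each leaf labelled 1,
    and a tree of height h has at most 2^h leaves. *)
Lemma proto_cover X Y (q : proto X Y) :
  exists2 L, size L <= 2 ^ pheight q & covers (peval q) L.
Proof.
have size_le m0 m1 n0 n1 : n0 <= 2 ^ m0 -> n1 <= 2 ^ m1 ->
    n0 + n1 <= 2 ^ (maxn m0 m1).+1.
  move=> s0 s1; rewrite expnS mul2n -addnn.
  by apply: leq_add; [apply: leq_trans s0 _|apply: leq_trans s1 _];
    rewrite leq_exp2l ?leq_maxl ?leq_maxr.
elim: q => [[]|f q0 [L0 s0 c0] q1 [L1 s1 c1]|g q0 [L0 s0 c0] q1 [L1 s1 c1]].
- by exists [:: (predT : pred X, predT : pred Y)].
- by exists [::].
- exists ([seq (fun x => ~~ f x && r.1 x, r.2) | r <- L0] ++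
          [seq (fun x => f x && r.1 x, r.2) | r <- L1]).
    by rewrite size_cat !size_map; apply: size_le.
  move=> x y; rewrite has_cat !has_map /=.
  under eq_has => r do rewrite /= -andbA.
  under [X in _ || X]eq_has => r do rewrite /= -andbA.
  by rewrite !has_andl -c0 -c1; case: (f x); rewrite ?orbF.
- exists ([seq (r.1, fun y => ~~ g y && r.2 y) | r <- L0] ++
          [seq (r.1, fun y => g y && r.2 y) | r <- L1]).
    by rewrite size_cat !size_map; apply: size_le.
  move=> x y; rewrite has_cat !has_map /=.
  under eq_has => r do rewrite /= andbCA.
  under [X in _ || X]eq_has => r do rewrite /= andbCA.
  by rewrite !has_andl -c0 -c1; case: (g y); rewrite ?orbF.
Qed.

(** Pool the covers of all [pi a]: there are [2 ^ k] advice strings, each with at most 2^(maximal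
    height) rectangles, and the exponents add up to the cost. *)
Lemma cover_Ncc (X Y : finType) (P : X -> Y -> bool) :
  exists2 L, size L <= 2 ^ Ncc P & covers P L.
Proof.
have [k [pi [piP <-]]] := NccP P.
have [L LP] : {L & forall a, size (L a) <= 2 ^ pheight (pi a) /\ covers (peval (pi a)) (L a)}.
  apply: (choice (P := fun a L => size L <= 2 ^ pheight (pi a) /\ covers (peval (pi a)) L)) => a.
  by have [L] := proto_cover (pi a); exists L.
exists (flatten [seq L a | a <- index_enum (k.-tuple bool : finType)]).
  rewrite size_flatten sumnE !big_map.
  apply: (@leq_trans (\sum_(a : k.-tuple bool) 2 ^ \max_(a : k.-tuple bool) pheight (pi a))).
    by apply: leq_sum => a _; apply: leq_trans (LP a).1 _; rewrite leq_exp2l //; apply: leq_bigmax.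
  by rewrite sum_nat_const card_tuple card_bool expnD.
have has_flatten p s : has p (flatten s) = has (has p) s :> bool.
  by elim: s => //= r s <-; rewrite has_cat.
move=> x y; rewrite piP has_flatten has_map; apply/existsP/hasP => [[a]|[a _ /=]].
  by rewrite (LP a).2 => h; exists a; rewrite ?mem_index_enum.
by rewrite -(LP a).2; exists a.
Qed.

(** Cost 0 forces every [pi a] to be a leaf. Such queries need separate treatment because they pay
    for no loss of density. *)
Lemma Ncc0_const (X Y : finType) (P : X -> Y -> bool) :
  Ncc P = 0 -> exists b, forall x y, P x y = b.
Proof.
have [k [pi [piP <-]]] := NccP P; rewrite /nd_cost => /eqP.
rewrite addn_eq0 => /andP[_ /eqP h0].
have leaf a : exists b, pi a = Leaf X Y b.
  have := leq_bigmax (F := fun a => pheight (pi a)) a; rewrite h0.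
  by case: (pi a) => // b _; exists b.
exists [exists a, if pi a is Leaf b then b else false] => x y; rewrite piP.
by apply: eq_existsb => a; have [b ->] := leaf a.
Qed.

(** * Large constant rectangles of oracle protocols *)

Lemma card_union_le (X : finType) (S : {set X}) m (L : seq (pred X)) :
  all (fun r => #|[set x in S | r x]| * m <= #|S|) L ->
  #|[set x in S | has (fun r => r x) L]| * m <= size L * #|S|.
Proof.
elim: L => [_|r L IH /= /andP[rS /IH LS]].
  by rewrite (_ : finset _ = finset.set0) ?cards0 //; apply/setP => x; rewrite !inE andbF.
rewrite (_ : finset _ = [set x in S | r x] :|: [set x in S | has (fun r => r x) L]); last first.
  by apply/setP => x; rewrite !inE -andb_orr.
apply: (leq_trans (leq_mul (leq_card_setU _ _) (leqnn m))).
by rewrite mulnDl mulSn leq_add.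
Qed.

(** Union bound: [2 ^ k] pieces of relative size at most 1 / [2 ^ k.+1] cover at most half of
    [S]. *)
Lemma card_avoid (X : finType) (S : {set X}) k (L : seq (pred X)) :
  size L <= 2 ^ k -> all (fun r => #|[set x in S | r x]| * 2 ^ k.+1 <= #|S|) L ->
  #|S| <= 2 * #|[set x in S | ~~ has (fun r => r x) L]|.
Proof.
move=> sL /card_union_le; set U := finset _; set V := finset _ => le.
have cS : #|S| = #|U| + #|V|.
  rewrite -(cardsID [set x | has (fun r => r x) L] S); congr addn;
  by apply: eq_card => x; rewrite !inE // andbC.
have {le} le : #|U| * 2 ^ k.+1 <= 2 ^ k * #|S|.
  by apply: leq_trans le _; rewrite leq_mul2r sL orbT.
move: le; rewrite expnS mulnCA mulnA -mulnA [X in X <= _]mulnCA.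
rewrite [2 * _]mulnC; have := expn_gt0 2 k; nia.
Qed.

(* If every rectangle is small then each has a short side; deleting the short
   sides removes at most half of the rows and half of the columns. *)
Lemma big_rect_or_avoid (X Y : finType) (S : {set X}) (T : {set Y}) k
    (L : seq (pred X * pred Y)) : size L <= 2 ^ k ->
  has (fun r : pred X * pred Y => #|S| * #|T| <=
     #|[set x in S | r.1 x]| * #|[set y in T | r.2 y]| * 2 ^ (2 * k.+1)) L \/
  exists (S' : {set X}) (T' : {set Y}),
  [/\ S' \subset S, T' \subset T, #|S| * #|T| <= #|S'| * #|T'| * 4 &
    forall x y, x \in S' -> y \in T' -> ~~ has (fun r => r.1 x && r.2 y) L].
Proof.
move=> sL; case: (boolP (has _ L)) => [|]; first by left.
rewrite -all_predC => small; right.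
pose short_row (r : pred X * pred Y) := #|[set x in S | r.1 x]| * 2 ^ k.+1 <= #|S|.
pose short_col (r : pred X * pred Y) := #|[set y in T | r.2 y]| * 2 ^ k.+1 <= #|T|.
(* A rectangle with a long side contributes an empty predicate for that side, so both lists keep the
   length of [L]. *)
pose rows := [seq (fun x => short_row r && r.1 x) | r <- L].
pose cols := [seq (fun y => short_col r && r.2 y) | r <- L].
exists [set x in S | ~~ has (fun r => r x) rows].
exists [set y in T | ~~ has (fun r => r y) cols].
have restrict_short (Z : finType) (U : {set Z}) (p : pred Z) :
    #|[set z in U | (#|[set z in U | p z]| * 2 ^ k.+1 <= #|U|) && p z]| * 2 ^ k.+1 <= #|U|.
  case: (boolP (#|[set z in U | p z]| * 2 ^ k.+1 <= #|U|)) => [//|_].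
  by rewrite (_ : finset _ = finset.set0) ?cards0 //; apply/setP => x; rewrite !inE andbF.
split.
- by apply/fintype.subsetP => x; rewrite inE => /andP[].
- by apply/fintype.subsetP => y; rewrite inE => /andP[].
- have rS : #|S| <= 2 * #|[set x in S | ~~ has (fun r => r x) rows]|.
    apply: (@card_avoid _ _ k); rewrite ?size_map //.
    rewrite all_map (eq_all (a2 := predT)) ?all_predT // => r /=.
    exact: restrict_short.
  have cT : #|T| <= 2 * #|[set y in T | ~~ has (fun r => r y) cols]|.
    apply: (@card_avoid _ _ k); rewrite ?size_map //.
    rewrite all_map (eq_all (a2 := predT)) ?all_predT // => r /=.
    exact: restrict_short.
  by apply: leq_trans (leq_mul rS cT) _; lia.
- move=> x y; rewrite !inE !has_map -!all_predC => /andP[_ xr] /andP[_ yc].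
  have := conj xr yc => /andP; rewrite -all_predI => /(conj small) /andP.
  rewrite -all_predI; apply: sub_all => r /= /and3P[].
  (* A rectangle containing a surviving pair has both sides long; multiplying the two bounds
     contradicts [small]. *)
  rewrite -ltnNge mul2n -addnn expnD /short_row /short_col => big.
  case: (r.1 x) => //; case: (r.2 y) => //; rewrite !andbT -!ltnNge => rS cT.
  by have := ltn_mul rS cT; lia.
Qed.

Lemma majority_value (X : finType) (S : {set X}) (f : X -> bool) :
  exists b, #|S| <= 2 * #|[set x in S | f x == b]|.
Proof.
have cS : #|S| = #|[set x in S | f x == true]| + #|[set x in S | f x == false]|.
  rewrite -(cardsID [set x | f x] S); congr addn; apply: eq_card => x;
  by rewrite !inE ?eqb_id ?eqbF_neg // andbC.
by case: (leqP #|[set x in S | f x == true]| #|[set x in S | f x == false]|) => le;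
  [exists false|exists true]; lia.
Qed.

(** Induction on the tree, following one branch. A communicated bit costs a factor 2 of area; a
    query with N = [Ncc P] positive costs at most 2^(2(N+1)), which is at most 2^(4N). This is the
    origin of the constant 4. *)
Lemma oproto_monorect (X Y : finType) (p : oproto X Y) (S : {set X}) (T : {set Y}) :
  exists (S' : {set X}) (T' : {set Y}) b, [/\ S' \subset S, T' \subset T,
    #|S| * #|T| <= #|S'| * #|T'| * 2 ^ (4 * ocost p) &
    forall x y, x \in S' -> y \in T' -> oeval p x y = b].
Proof.
pose mono (q : oproto X Y) (S : {set X}) (T : {set Y}) c :=
  exists (S' : {set X}) (T' : {set Y}) b, [/\ S' \subset S, T' \subset T,
  #|S| * #|T| <= #|S'| * #|T'| * 2 ^ c &
  forall x y, x \in S' -> y \in T' -> oeval q x y = b].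
(* Common induction step: a subrectangle on which [q] acts as the subprotocol [q'] is reached at a
   loss of [2 ^ a], and the losses multiply. *)
have shrink q q' (S1 S0 : {set X}) (T1 T0 : {set Y}) a c c' :
    S1 \subset S0 -> T1 \subset T0 -> #|S0| * #|T0| <= #|S1| * #|T1| * 2 ^ a ->
    (forall x y, x \in S1 -> y \in T1 -> oeval q x y = oeval q' x y) ->
    a + c' <= c -> mono q' S1 T1 c' -> mono q S0 T0 c.
  move=> S10 T10 le qq' ac [S' [T' [b [S'1 T'1 le' const]]]].
  exists S', T', b; split.
  - exact: fintype.subset_trans S10.
  - exact: fintype.subset_trans T10.
  - apply: leq_trans le _; apply: (leq_trans (leq_mul le' (leqnn _))).
    by rewrite -mulnA -expnD leq_mul2l leq_exp2l // addnC ac orbT.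
  - move=> x y xS yT; rewrite qq' ?const //.
      by apply: (fintype.subsetP S'1).
    by apply: (fintype.subsetP T'1).
have subS (Z : finType) (U : {set Z}) (P : pred Z) : [set z in U | P z] \subset U.
  by apply/fintype.subsetP => z; rewrite inE => /andP[].
rewrite -/(mono p S T (4 * ocost p)).
elim: p S T => [b|f p0 IH0 p1 IH1|g p0 IH0 p1 IH1|X' Y' P a b p0 IH0 p1 IH1] S T.
- by exists S, T, b; split; rewrite ?muln1.
- have [v fv] := majority_value S f.
  apply: (@shrink _ (if v then p1 else p0) [set x in S | f x == v] _ T _ 1
    _ (4 * ocost (if v then p1 else p0))) => //=; last by case: (v).
  + by rewrite mulnAC leq_mul2r mulnC fv orbT.
  + by move=> x y; rewrite inE => /andP[_ /eqP ->]; case: (v).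
  + by case: (v); lia.
- have [v gv] := majority_value T g.
  apply: (@shrink _ (if v then p1 else p0) S _ [set y in T | g y == v] _ 1
    _ (4 * ocost (if v then p1 else p0))) => //=; last by case: (v).
  + by rewrite -mulnA leq_mul2l mulnC gv orbT.
  + by move=> x y _; rewrite inE => /andP[_ /eqP ->]; case: (v).
  + by case: (v); lia.
have [N0|Npos] := posnP (Ncc P).
  have [v Pv] := Ncc0_const N0.
  apply: (@shrink _ (if v then p1 else p0) S _ T _ 0
    _ (4 * ocost (if v then p1 else p0))) => //=; rewrite ?muln1 //.
  + by move=> x y _ _; rewrite Pv; case: (v).
  + by case: (v); lia.
  + by case: (v).
have [L sL LP] := cover_Ncc P.
(* Pulling back along [a] and [b] measures the rectangles inside [S * T], so the size of the oracle
   matrix is immaterial. *)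
pose pull (r : pred X' * pred Y') : pred X * pred Y := (r.1 \o a, r.2 \o b).
have [|big|[S' [T' [S'S T'T le avoid]]]] :=
  @big_rect_or_avoid _ _ S T (Ncc P) (map pull L).
- by rewrite size_map.
- have [r [le Pr]] : exists r : pred X * pred Y, #|S| * #|T| <=
      #|[set x in S | r.1 x]| * #|[set y in T | r.2 y]| * 2 ^ (2 * (Ncc P).+1) /\
      forall x y, r.1 x -> r.2 y -> P (a x) (b y).
    have Pr (x : X) (y : Y) : has (fun r => r.1 x && r.2 y) (map pull L) -> P (a x) (b y).
      by rewrite LP has_map.
    elim: (map pull L) big Pr => //= r l IH /orP[le|/IH {}IH] Pr.
      by exists r; split => // x y rx ry; apply: Pr; rewrite rx ry.
    by apply: IH => x y h; apply: Pr; rewrite h orbT.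
  apply: (shrink _ p1 _ _ _ _ _ _ (4 * ocost p1) (subS _ _ _) (subS _ _ _) le) => //=.
    by move=> x y; rewrite !inE => /andP[_ rx] /andP[_ ry]; rewrite Pr.
  by lia.
- apply: (shrink _ p0 _ _ _ _ 2 _ (4 * ocost p0) S'S T'T) => //=.
    move=> x y xS yT; rewrite LP.
    by have := avoid x y xS yT; rewrite has_map => /negbTE ->.
  by lia.
Qed.

(** * Linear lower bound for [DNP] *)

(** A single query to [F] itself computes [F], so the minimum is attained. *)
Lemma DNPP (X Y : finType) (F : X -> Y -> bool) :
  exists2 p : oproto X Y, forall x y, oeval p x y = F x y & ocost p = DNP F.
Proof.
have [|p [pF pc]] := natminP (P := fun c => exists p : oproto X Y,
  (forall x y, oeval p x y = F x y) /\ ocost p = c); last by exists p.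
pose p := OOracle F id id (OLeaf X Y false) (OLeaf X Y true).
by exists (ocost p), p; split => // x y /=; case: (F x y).
Qed.

Lemma DNP_monorect (X Y : finType) (F : X -> Y -> bool) :
  exists S T, monorect F S T /\ #|X| * #|Y| <= #|S| * #|T| * 2 ^ (4 * DNP F).
Proof.
have [p pF <-] := DNPP F.
have [S [T [b [_ _ le const]]]] := oproto_monorect p [set: X]%SET [set: Y]%SET.
exists S, T; split; last by rewrite -!cardsT.
apply/existsP; exists b; apply/forallP => x; apply/implyP => xS.
by apply/forallP => y; apply/implyP => yT; rewrite -pF const.
Qed.

(** The two rectangle bounds give (32/25)^n at most 2^(4D), where D is the [DNP] cost. Cubing yields
    12 = 3 * 4, since 2 * 25^3 = 31250 is at most 32^3 = 32768. *)
Lemma DNP_far n : n <= 12 * DNP (@far n).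
Proof.
have [S [T [/far_monorect_card le]]] := DNP_monorect (@far n).
rewrite card_tuple card_bool -expnMn => le'.
have key : 32 ^ n <= 25 ^ n * 2 ^ (4 * DNP (@far n)).
  rewrite -(leq_pmul2l (_ : 0 < (2 * 2) ^ n)) ?expn_gt0 //.
  rewrite [X in _ <= X]mulnA -[(2 * 2) ^ n * 25 ^ n]expnMn.
  apply: leq_trans (leq_mul le' (leqnn _)) _.
  by rewrite mulnAC leq_mul2r le orbT.
rewrite -(leq_exp2l _ _ (ltnSn 1)) -(leq_pmul2l (_ : 0 < (25 ^ n) ^ 3)) ?expn_gt0 //.
rewrite (_ : 12 * _ = 4 * DNP (@far n) * 3); last by lia.
rewrite [2 ^ (_ * 3)]expnM -expnMn; apply: (@leq_trans ((32 ^ n) ^ 3)); last first.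
  by rewrite leq_exp2r.
rewrite -!expnM ![n * 3]mulnC !expnM -expnMn.
have [->|n0] := posnP n; first by rewrite !expn0.
by rewrite leq_exp2r // !expnS !expn0; lia.
Qed.

Lemma sqr_le_exp2 j : 4 <= j -> j * j <= 2 ^ j.
Proof.
elim: j => // j IH; rewrite leq_eqVlt => /orP[/eqP <- //|j4].
by have := IH j4; rewrite expnS; nia.
Qed.

Local Open Scope ring_scope.

(** * Logarithmic upper bound for [PPcc] *)

Section Real.
Variable R : realType.

Lemma ln2_gt0 : 0 < ln 2 :> R.
Proof. by rewrite ln_gt0 // ltr1n. Qed.

Lemma log2_pow2 m : log2 (2 ^+ m) = m%:R :> R.
Proof. by rewrite /log2 lnXn // -[ln 2 *+ m]mulr_natl mulfK // gt_eqF // ln2_gt0. Qed.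

Lemma log2M (x y : R) : 0 < x -> 0 < y -> log2 (x * y) = log2 x + log2 y.
Proof. by move=> x0 y0; rewrite /log2 lnM ?posrE // mulrDl. Qed.

Lemma le_log2 (x y : R) : 0 < x -> x <= y -> log2 x <= log2 y.
Proof.
move=> x0 xy; rewrite /log2 ler_pM2r ?invr_gt0 ?ln2_gt0 //.
by rewrite ler_ln ?posrE // (lt_le_trans x0).
Qed.

Lemma PPcc_le X Y (F : X -> Y -> bool) (e : R) (s : rproto R X Y) :
  0 <= e -> e < 2^-1 -> rvalid s -> (forall x y, rerr F s x y <= e) ->
  PPcc R F <= (rcost s)%:R + log2 (1 / (2^-1 - e)).
Proof.
move=> e0 e2 sv se.
apply: (@le_trans _ _ ((Rcc e F)%:R + log2 (1 / (2^-1 - e)))).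
  apply: ge_inf; last by exists e.
  (* An element bounds [inf] only if the set is bounded below; 0 serves, as 1 / (1/2 - d) is at
     least 2. *)
  exists 0 => _ [d [d0 d2] <-]; apply: addr_ge0 => //.
  apply: divr_ge0; last exact: ltW ln2_gt0.
  by apply: ln_ge0; rewrite ler_pdivlMr; lra.
by rewrite lerD2r ler_nat; apply: natmin_le; exists s.
Qed.

Lemma natr_doubleS n : (2 * n).+1%:R = 2 * n%:R + 1 :> R.
Proof. by rewrite -addn1 natrD natrM. Qed.

(* The constant protocol breaks the tie at distance [n / 2]. *)
Definition coord_rproto n : rproto R (bits n) (bits n) :=
  ((2 * n).+1%:R^-1, Leaf _ _ false) ::
  [seq (2 / (2 * n).+1%:R,
    ANode (fun x => tnth x i) (BNode (fun y => tnth y i) (Leaf _ _ false) (Leaf _ _ true))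
                              (BNode (fun y => tnth y i) (Leaf _ _ true) (Leaf _ _ false)))
  | i <- index_enum 'I_n].

Lemma coord_rproto_valid n : rvalid (coord_rproto n).
Proof.
split.
  rewrite /= invr_ge0 ler0n /= all_map; apply/allP => i _ /=.
  by rewrite divr_ge0.
rewrite big_cons big_map /= sumr_const card_ord -mulr_natl.
have : (2 * n).+1%:R != 0 :> R by rewrite pnatr_eq0.
rewrite natr_doubleS => h.
by field.
Qed.

Lemma coord_rproto_cost n : (rcost (coord_rproto n) <= 2)%N.
Proof.
rewrite /rcost big_cons big_map /=; case: ifP => _; rewrite ?max0n;
  by apply/bigmax_leqP_seq.
Qed.

(** Let h be the distance. If [far] holds, the constant and the n - h agreeing coordinates err, with
    weight (1 + 2(n - h)) / (2n + 1), and 2h is at least n + 1. Otherwise the h differing ones err,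
    with weight 2h / (2n + 1). *)
Lemma coord_rproto_err n (x y : bits n) :
  rerr (@far n) (coord_rproto n) x y <= n%:R / (2 * n).+1%:R.
Proof.
have weighted_count (w : R) (P : pred 'I_n) :
    \sum_(i < n | P i) w = (\sum_(i < n) P i)%:R * w.
  rewrite natr_sum mulr_suml big_mkcond; apply: eq_bigr => i _.
  by case: (P i); rewrite ?mul1r ?mul0r.
have dn : (hamming x y <= n)%N by rewrite -{2}(hamming_negb x y) leq_addl.
rewrite /rerr big_cons big_map /= weighted_count.
rewrite (_ : (\sum_(i < n) _)%N =
    if far x y then (n - hamming x y)%N else hamming x y); last first.
  case: (far x y).
    apply/eqP; rewrite -(eqn_add2r (hamming x y)) (subnK dn).
    apply/eqP; rewrite -big_split /= -[RHS]card_ord -sum1_card; apply: eq_bigr => i _.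
    by case: (tnth x i) (tnth y i) => [] [].
  by apply: eq_bigr => i _; case: (tnth x i) (tnth y i) => [] [].
have h0 : 0 <= (2 * n).+1%:R^-1 :> R by rewrite invr_ge0.
rewrite /far; case: ltnP => /= d.
  rewrite mulrA -[X in X + _]mul1r -mulrDl ler_wpM2r // -natrM -(natrD _ 1) ler_nat.
  lia.
by rewrite mulrA ler_wpM2r // -natrM ler_nat; lia.
Qed.

(** The advantage is 1 / (4n + 2) and 4n + 2 is at most 8n, so the total is at most 2 + 3 +
    [log2 n%:R]; the last term is at least 1. *)
Lemma PPcc_far n : (2 <= n)%N -> PPcc R (@far n) <= 6 * log2 n%:R.
Proof.
move=> n2.
have n2R : 2 <= n%:R :> R by rewrite (ler_nat _ 2).
have e2 : n%:R / (2 * n).+1%:R < 2^-1 :> R.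
  rewrite ltr_pdivrMr ?ltr0n // natr_doubleS; lra.
have := PPcc_le _ e2 (coord_rproto_valid n) (@coord_rproto_err n).
move=> /(_ ltac:(by rewrite divr_ge0)) h; apply: le_trans h _.
have -> : 1 / (2^-1 - n%:R / (2 * n).+1%:R) = 2 * (2 * n%:R + 1) :> R.
  rewrite natr_doubleS; field.
  by apply/andP; split; apply/eqP; lra.
have c2 : (rcost (coord_rproto n))%:R <= 2 :> R by rewrite (ler_nat _ _ 2) coord_rproto_cost.
have l8 : log2 (2 * (2 * n%:R + 1)) <= 3 + log2 n%:R :> R.
  have <- := log2_pow2 3; rewrite -log2M ?exprn_gt0 //; last by lra.
  apply: le_log2; lra.
have l1 : log2 2 <= log2 n%:R :> R by apply: le_log2.
have := log2_pow2 1; rewrite expr1 => l2.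
lra.
Qed.

(** * Exponentially small rectangles *)

Lemma rect_far n : 2 `^ (3^-1 * n%:R) <= (rect R (@far n))^-1.
Proof.
(* Inverting the upper bound requires positivity, which a one-entry rectangle provides. *)
have rect_gt0 : 0 < rect R (@far n).
  pose x0 : bits n := nseq_tuple n false.
  have mono : monorect (@far n) [set x0] [set x0].
    apply/existsP; exists (far x0 x0).
    apply/forallP => x; apply/implyP; rewrite inE => /eqP ->.
    by apply/forallP => y; apply/implyP; rewrite inE => /eqP ->.
  apply: lt_le_trans (le_bigmax _ _ [set x0]%SET).
  apply: lt_le_trans (le_bigmax_cond _ _ mono).
  by rewrite !cards1 divr_gt0 // ltr0n card_tuple card_bool muln_gt0 expn_gt0.
have rect_le : rect R (@far n) <= (25 / 32) ^+ n.
  apply: bigmax_le => [|S _]; first by rewrite exprn_ge0 // divr_ge0.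
  apply: bigmax_le => [|T mono]; first by rewrite exprn_ge0 // divr_ge0.
  rewrite ler_pdivrMr ?ltr0n ?card_tuple ?card_bool ?muln_gt0 ?expn_gt0 //.
  rewrite expr_div_n mulrAC ler_pdivlMr ?exprn_gt0 // -!natrX -!natrM ler_nat.
  by rewrite -!expnMn; apply: far_monorect_card.
apply: (@le_trans _ _ ((32 / 25) ^+ n)); last first.
  by rewrite -[32 / 25]invf_div exprVn lef_pV2 ?posrE ?exprn_gt0 // divr_gt0.
rewrite powRrM powR_mulrn ?powR_ge0 // lerXn2r ?nnegrE ?powR_ge0 //; first by lra.
(* The exponent 1/3 works because 2 is at most (32/25)^3. *)
rewrite -(@ler_pXn2r _ 3) ?nnegrE ?powR_ge0 //; last by lra.
rewrite -powR_mulrn ?powR_ge0 // -powRrM mulVf ?pnatr_eq0 // powRr1 ?ler0n //; lra.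
Qed.

(** * Separation of the classes *)

(** For n = 2^m with m = 2^j, the logarithm is m. Since B < m and j exceeds k, B m^k < m^(k+1) =
    2^(j(k+1)), which is at most 2^(j^2) and hence at most 2^m = n. *)
Lemma polylog_lt_linear (C c : R) k N0 :
  0 < c -> exists2 n, (N0 <= n)%N & C * log2 n%:R ^+ k < c * n%:R.
Proof.
move=> c0; pose B := (Num.trunc (C / c)).+1.
have CB : C <= c * B%:R by rewrite mulrC -ler_pdivrMr // ltW // truncnS_gt.
pose j := (4 + k + N0 + B)%N.
have jj : (j < 2 ^ j)%N by rewrite ltn_expl.
exists (2 ^ (2 ^ j))%N.
  by have := ltn_expl (2 ^ j) (ltnSn 1); rewrite /j in jj *; lia.
rewrite natrX log2_pow2.
apply: (@le_lt_trans _ _ (c * B%:R * (2 ^ j)%:R ^+ k)).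
  by rewrite ler_wpM2r // exprn_ge0.
rewrite -mulrA ltr_pM2l // -!natrX -natrM ltr_nat.
apply: (@leq_trans (2 ^ j * (2 ^ j) ^ k)).
  rewrite ltn_pmul2r ?expn_gt0 //; rewrite /j in jj *; lia.
rewrite -expnS -expnM leq_exp2l //; apply: leq_trans (@sqr_le_exp2 j _); last by rewrite /j; lia.
by rewrite leq_mul2l /j; lia.
Qed.

End Real.

Theorem theorem5p19 (R : realType) :
  exists F : bfamily,
    (* PP(F_n) = O(log n) *)
    (exists (C : R) (N0 : nat), forall n, (N0 <= n)%N ->
        PPcc R (F n) <= C * log2 n%:R) /\
    (* rect(F_n)^{-1} = 2^{Omega(n)} *)
    (exists (c : R) (N0 : nat), 0 < c /\ forall n, (N0 <= n)%N ->
        2 `^ (c * n%:R) <= (rect R (F n))^-1) /\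
    (* D^NP(F_n) = Omega(n) *)
    (exists (c : R) (N0 : nat), 0 < c /\ forall n, (N0 <= n)%N ->
        c * n%:R <= (DNP (F n))%:R) /\
    (* hence PP is not contained in P^NP, witnessed by F *)
    in_PP R F /\ ~ in_PNP R F.
Proof.
have DNP_ge n : 12^-1 * n%:R <= (DNP (@far n))%:R :> R.
  by rewrite ler_pdivrMl // -natrM ler_nat DNP_far.
exists far; split; first by exists 6, 2%N; exact: PPcc_far.
split; first by exists 3^-1, 0%N; split=> [|n _]; [rewrite invr_gt0 ltr0n | apply: rect_far].
split; first by exists 12^-1, 0%N; split; first by rewrite invr_gt0 ltr0n.
split; first by exists 6, 1%N, 2%N => n n2; rewrite expr1; apply: PPcc_far.
move=> [C [k [N0 le]]].
have [|n N0n] := @polylog_lt_linear R C 12^-1 k N0; first by rewrite invr_gt0 ltr0n.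
by apply/negP; rewrite -leNgt (le_trans (DNP_ge n)) // le.
Qed.
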